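(* Let $p\ge1$, let $T>0$, let $\pi=(\pi_n)_{n\ge1}$ be a sequence of partitions of $[0,T]$ with vanishing mesh, and let $x\in V^p_\pi([0,T],\mathbb{R})$. Put $\phi(t)=[x]^{(p)}_\pi(t)$. Assume that $\phi\in C^1_b([0,T],\mathbb{R})$ and that there exist constants $c,C$ with $0<c\le\phi'\le C<\infty$ on $[0,T]$. Let $t\in[0,T]$; below $q$ ranges over positive reals. Then: (1) If $x\in\mathbb{S}^p_\pi([0,T],\mathbb{R})$ and $\langle x\rangle^{(p)}_\pi(t)>0$, then $\mu^{p,q}_\pi([0,t])=\infty$ for all $q<p$ and $\mu^{p,q}_\pi([0,t])=0$ for all $q>p$. (2a) If $\limsup_n\langle x\rangle^{(p)}_{\pi_n}(t)<\infty$, then $\limsup_n\mu^{p,q}_{n,\pi}([0,t])=0$ for all $q>p$. (2b) If $\limsup_n\langle x\rangle^{(p)}_{\pi_n}(t)>0$, then $\limsup_n\mu^{p,q}_{n,\pi}([0,t])=\infty$ for all $q<p$. (3a) If $\liminf_n\langle x\rangle^{(p)}_{\pi_n}(t)<\infty$, then $\liminf_n\mu^{p,q}_{n,\pi}([0,t])=0$ for all $q>p$. (3b) If $\liminf_n\langle x\rangle^{(p)}_{\pi_n}(t)>0$, then $\liminf_n\mu^{p,q}_{n,\pi}([0,t])=\infty$ for all $q<p$.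
   Context: A sequence of partitions $\pi=(\pi_n)_{n\ge1}$ of $[0,T]$ consists of finite partitions $\pi_n=(0=t^n_0<t^n_1<\dots<t^n_{N(\pi_n)}=T)$; it has vanishing mesh if $\max_i (t^n_{i+1}-t^n_i)\to0$. We write $[t_j,t_{j+1}]\in\pi_n$ when $t_j<t_{j+1}$ are consecutive points of $\pi_n$, and $\bigtriangleup x(t_j):=x(t_{j+1})-x(t_j)$. The oscillation of $x\in C([0,T],\mathbb{R})$ along $\pi_n$ is $\mathrm{osc}(x,\pi_n):=\max_{[t_j,t_{j+1}]\in\pi_n}\max_{r,s\in[t_j,t_{j+1}]}|x(s)-x(r)|$. $\delta(\cdot-s)$ denotes the Dirac mass at $s$; measures are finite measures on $[0,T]$ and convergence is weak convergence. $p$-th variation: a continuous $x:[0,T]\to\mathbb{R}$ belongs to $V^p_\pi([0,T],\mathbb{R})$ if $\mathrm{osc}(x,\pi_n)\to0$ and the measures $\mu^n:=\sum_{[t_j,t_{j+1}]\in\pi_n}\delta(\cdot-t_j)|\bigtriangleup x(t_j)|^p$ converge weakly to a measure $\mu$ without atoms. Then $[x]^{(p)}_\pi(t):=\mu([0,t])$ is the $p$-th variation of $x$ along $\pi$, and $\Delta[x]^{(p)}_\pi(t_j):=[x]^{(p)}_\pi(t_{j+1})-[x]^{(p)}_\pi(t_j)$ for $[t_j,t_{j+1}]\in\pi_n$. Scaled quadratic variation of index $p$: with $\gamma=\frac{p-2}{p}$, set $$\mu^n_{SQV}:=\sum_{[t_j,t_{j+1}]\in\pi_n}\delta(\cdot-t_j)\big(\Delta[x]^{(p)}_\pi(t_j)\big)^\gamma|\bigtriangleup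 x(t_j)|^2\,\mathbf{1}_{\Delta[x]^{(p)}_\pi(t_j)>0},\qquad \langle x\rangle^{(p)}_{\pi_n}(t):=\mu^n_{SQV}([0,t]).$$ The path $x\in V^p_\pi([0,T],\mathbb{R})$ belongs to $\mathbb{S}^p_\pi([0,T],\mathbb{R})$ if $\mu^n_{SQV}$ converges weakly to a measure $\mu_{SQV}$ without atoms; then $\langle x\rangle^{(p)}_\pi(t):=\mu_{SQV}([0,t])$. Scaled quadratic variation of order $q>0$ with reference $p$: $$\mu^{p,q}_{n,\pi}:=\sum_{[t_j,t_{j+1}]\in\pi_n}\delta(\cdot-t_j)\big(\Delta[x]^{(p)}_\pi(t_j)\big)^{\frac{q-2}{q}}(\bigtriangleup x(t_j))^2\,\mathbf{1}_{\Delta[x]^{(p)}_\pi(t_j)>0},$$ and $\mu^{p,q}_\pi([0,t]):=\lim_{n\to\infty}\mu^{p,q}_{n,\pi}([0,t])\in[0,\infty]$ (statement (1) includes the existence of this limit). In all these sums, terms with $\Delta[x]^{(p)}_\pi(t_j)=0$ are taken to be $0$ whatever the exponent. *)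

(* Defs.v *)
From HB Require Import structures.
From mathcomp Require Import all_boot all_order all_algebra.
From mathcomp Require Import all_classical all_reals all_analysis.

Set Implicit Arguments.
Unset Strict Implicit.
Unset Printing Implicit Defensive.
Import Order.TTheory GRing.Theory Num.Theory.
Import numFieldNormedType.Exports.

Local Open Scope classical_set_scope.
Local Open Scope ring_scope.

(* A partition 0 = t_0 < ... < t_N = T is a list s with [itv_partition 0 T s]:
   the list omits t_0 = 0, so that N = size s. *)
Definition part_pt {R : realType} (s : seq R) (j : nat) : R := nth 0 (0 :: s) j.

Definition incr {R : realType} (f : R -> R) (s : seq R) (j : nat) : R :=
  f (part_pt s j.+1) - f (part_pt s j).

Definition mesh {R : realType} (s : seq R) : R :=
  \big[Num.max/0]_(j < size s) (part_pt s j.+1 - part_pt s j).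

(* the sup is a max when x is continuous *)
Definition osc {R : realType} (x : R -> R) (s : seq R) : R :=
  \big[Num.max/0]_(j < size s)
    sup [set `|x v - x u| | u in `[part_pt s j, part_pt s j.+1]
                          & v in `[part_pt s j, part_pt s j.+1]].

(* Measures on [0, T] are Borel measures on R that vanish outside [0, T]. *)
Notation borel_measure R := {measure set (measurableTypeR R) -> \bar R}.
Notation finite_borel_measure R :=
  {finite_measure set (measurableTypeR R) -> \bar R}.

Definition weak_cvg {R : realType} (T : R) (mu_ : nat -> borel_measure R)
    (mu : borel_measure R) : Prop :=
  forall f : R -> R, {within `[0, T], continuous f} ->
    (\int[mu_ n]_(s in `[0%R, T]) (f s)%:E)%E @[n --> \oo] -->
    (\int[mu]_(s in `[0%R, T]) (f s)%:E)%E.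

Definition atomless_weak_limit {R : realType} (T : R)
    (mu_ : nat -> borel_measure R) (mu : finite_borel_measure R) : Prop :=
  [/\ mu (~` `[0, T]) = 0%E, forall s : R, mu [set s] = 0%E
    & weak_cvg T mu_ mu].

(* The atomless weak limit, which is unique; the zero measure if there is
   none. *)
Definition weak_limit {R : realType} (T : R) (mu_ : nat -> borel_measure R) :
    borel_measure R :=
  match pselect (exists mu, atomless_weak_limit T mu_ mu) with
  | left h => projT1 (cid h)
  | right _ => mzero
  end.

(* the measure \sum_j w_j \delta_{t_j}, over the left end points t_j, j < N *)
Definition dirac_sum {R : realType} (s : seq R) (w : nat -> {nonneg R}) :
    borel_measure R :=
  msum (fun j => mscale (w j) (dirac (part_pt s j : measurableTypeR R))) (size s).

Section scaled_variations.
Context {R : realType}.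
Implicit Types (p q a T : R) (pi : nat -> seq R) (x : R -> R).

(* \mu^n *)
Definition pvar_measure p pi x (n : nat) : borel_measure R :=
  dirac_sum (pi n) (fun j => NngNum (powR_ge0 `|incr x (pi n) j| p)).

Definition in_Vp p T pi x : Prop :=
  [/\ {within `[0, T], continuous x},
      osc x (pi n) @[n --> \oo] --> 0
    & exists mu, atomless_weak_limit T (pvar_measure p pi x) mu].

(* [x]^{(p)}_\pi *)
Definition pvar p T pi x (t : R) : R :=
  fine (weak_limit T (pvar_measure p pi x) `[0, t]%classic).

(* The last factor is the indicator of dphi > 0; without it the weight at
   dphi = 0 would depend on the value given to 0 `^ a. *)
Definition scaled_weight a (dphi dx : R) : R :=
  dphi `^ a * dx ^+ 2 * (0 < dphi)%R%:R.

Lemma scaled_weight_ge0 a (dphi dx : R) : 0 <= scaled_weight a dphi dx.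
Proof. by rewrite mulr_ge0 ?ler0n// mulr_ge0 ?powR_ge0 ?sqr_ge0. Qed.

Definition scaled_measure a p T pi x (n : nat) : borel_measure R :=
  dirac_sum (pi n) (fun j => NngNum
    (scaled_weight_ge0 a (incr (pvar p T pi x) (pi n) j) (incr x (pi n) j))).

(* \mu^n_{SQV} *)
Definition sqv_measure p T pi x : nat -> borel_measure R :=
  scaled_measure ((p - 2) / p) p T pi x.

(* <x>^{(p)}_{\pi_n}(t) *)
Definition sqv_n p T pi x (n : nat) (t : R) : \bar R :=
  sqv_measure p T pi x n `[0, t]%classic.

Definition in_Sp p T pi x : Prop :=
  in_Vp p T pi x /\
  exists mu, atomless_weak_limit T (sqv_measure p T pi x) mu.

(* <x>^{(p)}_\pi(t) *)
Definition sqv p T pi x (t : R) : R :=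
  fine (weak_limit T (sqv_measure p T pi x) `[0, t]%classic).

(* \mu^{p,q}_{n,\pi} *)
Definition mupq p q T pi x : nat -> borel_measure R :=
  scaled_measure ((q - 2) / q) p T pi x.

End scaled_variations.

(* The derivative on [0, T], one-sided at the end points. *)
Definition diff_quot {R : realType} (f : R -> R) (t s : R) : R :=
  (f s - f t) / (s - t).

Definition derive_on {R : realType} (T : R) (f : R -> R) (t : R) : R :=
  lim (diff_quot f t s @[s --> within `[0, T] t^']).

Definition C1b {R : realType} (T : R) (f : R -> R) : Prop :=
  [/\ forall t, t \in `[0, T] -> cvg (diff_quot f t s @[s --> within `[0, T] t^']),
      {within `[0, T], continuous (derive_on T f)},
      [bounded f t | t in `[0, T]]
    & [bounded derive_on T f t | t in `[0, T]]].

(* Main.v *)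
Require Import Defs.
From HB Require Import structures.
From mathcomp Require Import all_boot all_order all_algebra.
From mathcomp Require Import all_classical all_reals all_analysis.
From mathcomp Require Import measurable_realfun.
Import Order.TTheory GRing.Theory Num.Theory.
Import numFieldNormedType.Exports.
Local Open Scope classical_set_scope.
Local Open Scope ring_scope.

(** Since [2/q - 2/q' = (q'-2)/q' - (q-2)/q], passing from order [q] to an order
    [q' > q] multiplies the [j]-th weight by [dphi_j `^ (2/q - 2/q')].  By the
    mean value theorem [dphi_j <= C * mesh], so the measure of order [q'] is at
    most [K_n] times the one of order [q], with [K_n --> 0].  Each claim
    compares the order [q] with the order [p], where the measure is the scaled
    quadratic variation.  In (1), weak convergence tested against [1] and
    against [s |-> max(0, t - s)] bounds the mass of [[0, t]] from above and
    away from 0. *)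

Set Implicit Arguments.
Unset Strict Implicit.
Unset Printing Implicit Defensive.

(** * Upper and lower limits under a vanishing factor *)

Section limn_esup_einf_facts.
Context {R : realType}.
Implicit Types (u v : (\bar R)^nat) (K : R^nat) (a : \bar R).

Lemma ereal_gt0_EFin a : (0 < a)%E -> exists2 d : R, 0 < d & (d%:E < a)%E.
Proof.
case: a => [r| |] // r0; last by exists 1; rewrite ?ltry.
exists (r / 2); first by rewrite divr_gt0.
by rewrite lte_fin ltr_pdivrMr// ltr_pMr// ltr1n.
Qed.

Lemma limn_esup_lt_near u a :
  (limn_esup u < a)%E -> \forall n \near \oo, (u n < a)%E.
Proof.
move=> /ereal_inf_lt[_ [A oA <-] supA]; apply: filterS oA => n An.
by apply: le_lt_trans supA; apply: ereal_sup_ubound; exists n.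
Qed.

Lemma limn_esup_le_near u a :
  (\forall n \near \oo, u n <= a)%E -> (limn_esup u <= a)%E.
Proof.
(* [limn_esup] is an infimum over the members of the filter, and the set where the bound holds is
   one of them. *)
move=> ua; apply: (@le_trans _ _ (ereal_sup (u @` [set n | (u n <= a)%E]))).
  by apply: ereal_inf_lbound; exists [set n | (u n <= a)%E].
by apply: ge_ereal_sup => _ [n + <-].
Qed.

Lemma lt_limn_einf_near u a :
  (a < limn_einf u)%E -> \forall n \near \oo, (a < u n)%E.
Proof.
rewrite lteNr => /limn_esup_lt_near; apply: filterS => n.
by rewrite lteN2.
Qed.

Lemma le_limn_einf_near u a :
  (\forall n \near \oo, a <= u n)%E -> (a <= limn_einf u)%E.
Proof.
move=> ua; rewrite leeNr; apply: limn_esup_le_near; apply: filterS ua => n.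
by rewrite leeN2.
Qed.

Lemma limn_einf_pinfty_cvg u :
  limn_einf u = +oo%E -> u n @[n --> \oo] --> +oo%E.
Proof.
move=> uoo; apply/cvgeyPge => A.
have /lt_limn_einf_near : (A%:E < limn_einf u)%E by rewrite uoo ltry.
by apply: filterS => n /ltW.
Qed.

(** Eventually [v n] stays below a finite constant [M], so [u n] is at most [K n * M], which tends
    to 0. *)
Lemma limn_esup_dominated u v K : (forall n, 0 <= u n)%E ->
  (forall n, 0 <= K n) -> K n @[n --> \oo] --> 0 ->
  (forall n, u n <= (K n)%:E * v n)%E ->
  (limn_esup v < +oo)%E -> u n @[n --> \oo] --> 0%E.
Proof.
move=> u0 K0 Kcvg uKv vy; apply: limn_esup_le_cvg => //.
(* [M] is kept at least 1 because [e] is divided by it below; any [M] serves when the upper limit is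
   [-oo]. *)
have [M M0 vM] : exists2 M : R, 0 < M & (limn_esup v < M%:E)%E.
  case: (limn_esup v) vy => [r| |] // _; last by exists 1; rewrite ?ltNyr.
  exists (Num.max 1 (r + 1)); first by rewrite lt_max ltr01.
  by rewrite lte_fin lt_max ltrDl ltr01 orbT.
apply/lee_addgt0Pr => e e0; rewrite add0e.
have eM0 : 0 < e / M by rewrite divr_gt0.
apply: limn_esup_le_near.
have Ke : \forall n \near \oo, K n < e / M by apply: cvgr_lt Kcvg _ _.
near=> n.
apply: (le_trans (uKv n)); apply: (@le_trans _ _ ((K n)%:E * M%:E)%E).
  apply: lee_wpmul2l; first by rewrite lee_fin.
  by apply: ltW; near: n; exact: limn_esup_lt_near.
rewrite -EFinM lee_fin -ler_pdivlMr//; apply: ltW.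
by near: n.
Unshelve. all: by end_near. Qed.

(** Fix [d] strictly between 0 and [limn_einf u]. Once [K n < d / M], a value [v n < M] would force
    [u n <= d], which eventually fails; so [v n] is eventually at least any given [M]. *)
Lemma limn_einf_dominating u v K : (forall n, 0 <= v n)%E ->
  (forall n, 0 <= K n) -> K n @[n --> \oo] --> 0 ->
  (forall n, u n <= (K n)%:E * v n)%E ->
  (0 < limn_einf u)%E -> limn_einf v = +oo%E.
Proof.
move=> v0 K0 Kcvg uKv u_gt0.
have [d d0 du] := ereal_gt0_EFin u_gt0.
suff H (M : R) : 0 < M -> (M%:E <= limn_einf v)%E.
  apply/eqyP => M M0; exact: H.
move=> M0.
have dM0 : 0 < d / M by rewrite divr_gt0.
apply: le_limn_einf_near.
have Ke : \forall n \near \oo, K n < d / M by apply: cvgr_lt Kcvg _ _.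
near=> n.
rewrite leNgt; apply/negP => vM.
suff : (u n <= d%:E)%E.
  by apply/negP; rewrite -ltNge; near: n; exact: lt_limn_einf_near.
apply: (le_trans (uKv n)); apply: (@le_trans _ _ ((K n)%:E * M%:E)%E).
  by apply: lee_wpmul2l; rewrite ?lee_fin// ltW.
rewrite -EFinM lee_fin -ler_pdivlMr//; apply: ltW.
by near: n.
Unshelve. all: by end_near. Qed.

End limn_esup_einf_facts.

(** * From difference quotients on [[0, T]] to a bound on increments *)

Section one_sided_derivative.
Context {R : realType}.
Implicit Types (f : R -> R) (T : R).

(** Around an interior point [[0, T]] is a full neighbourhood, so the restricted limit is the
    two-sided one; the substitution [s = h + r] turns it into the quotient used by [is_derive]. *)
Lemma derive_on_is_derive T f r : 0 < r < T ->
  cvg (diff_quot f r s @[s --> within `[0, T] r^']) ->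
  is_derive r 1 f (derive_on T f r).
Proof.
move=> /andP[r0 rT] fr.
have nearT : \forall s \near r^', `[0, T]%classic s.
  apply: nbhs_dnbhs; near=> s; rewrite /= in_itv/=; apply/andP; split;
    apply/ltW.
    by near: s; exact: lt_nbhsr.
  by near: s; exact: lt_nbhsl.
have fr' : diff_quot f r s @[s --> r^'] --> derive_on T f r.
  move=> A Al; have /= := (fr : _ --> derive_on T f r) A Al.
  rewrite !nbhs_simpl /within /= => Ar.
  by apply: filterS2 nearT Ar => s rs; apply.
have shift_dnbhs : (h *: (1 : R) + r) @[h --> 0^'] --> r^'.
  move=> A rA; have : \forall s \near r, s != r -> A s by exact: rA.
  rewrite (near_shift 0) subr0 /= !nbhs_simpl /dnbhs /within /=.
  apply: filterS => h + h0; rewrite /= /GRing.scale/= mulr1; apply.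
  by rewrite -subr_eq0 addrK.
have dq : h^-1 *: ((f \o shift r) (h *: (1 : R)) - f r) @[h --> 0^'] -->
    derive_on T f r.
  have := cvg_comp _ _ shift_dnbhs fr'.
  apply: cvg_trans; apply: near_eq_cvg; near=> h.
  by rewrite /diff_quot /= addrK mulrC /GRing.scale/= mulr1.
by split; [apply/cvg_ex; exists (derive_on T f r)|exact/cvg_lim].
Unshelve. all: by end_near. Qed.

(** Off [r], [f s] equals [diff_quot f r s * (s - r) + f r], and the first term tends to 0. *)
Lemma diff_quot_continuous T f :
  (forall r, r \in `[0, T] ->
     cvg (diff_quot f r s @[s --> within `[0, T] r^'])) ->
  {within `[0, T], continuous f}.
Proof.
move=> df; apply/subspace_continuousP => r /= rT.
set l := derive_on T f r.
have fr : _ --> l := df _ rT.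
have sr0 : s - r @[s --> within `[0, T] r^'] --> r - r.
  apply: cvgB; last exact: cvg_cst.
  move=> A rA; rewrite /= !nbhs_simpl /within /=.
  by have := nbhs_dnbhs rA; apply: filterS.
have fr1 : diff_quot f r s * (s - r) + f r @[s --> within `[0, T] r^'] -->
    l * (r - r) + f r by apply: cvgD; [exact: cvgM|exact: cvg_cst].
rewrite subrr mulr0 add0r in fr1.
move=> A Ar; have fA : \forall s \near r, s != r -> s \in `[0, T] ->
    A (diff_quot f r s * (s - r) + f r) by exact: (fr1 A Ar).
rewrite /= !nbhs_simpl /within /=; apply: filterS fA => s sA sT.
have [->|sr] := eqVneq s r; first exact: nbhs_singleton Ar.
have := sA sr sT.
by rewrite /diff_quot divfK ?subr_eq0// subrK.
Qed.

(** Mean value theorem on [[u, v]]: its interior lies inside []0, T[], where [derive_on] is a true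
    derivative, and continuity up to the end points comes from [diff_quot_continuous]. *)
Lemma incr_le_derive_on T f C u v :
  (forall r, r \in `[0, T] ->
     cvg (diff_quot f r s @[s --> within `[0, T] r^'])) ->
  (forall r, r \in `[0, T] -> derive_on T f r <= C) ->
  0 <= u -> u < v -> v <= T -> f v - f u <= C * (v - u).
Proof.
move=> df fC u0 uv vT.
have sub r : r \in `]u, v[ -> 0 < r < T.
  by rewrite in_itv/= => /andP[ur rv];
    rewrite (le_lt_trans u0) ?(lt_le_trans rv).
have sub' r : 0 < r < T -> r \in `[0, T].
  by rewrite in_itv/= => /andP[/ltW -> /ltW ->].
have [||r ruv ->] := @MVT _ f (derive_on T f) _ _ uv.
- by move=> r /sub rT; apply: derive_on_is_derive => //; exact/df/sub'.
- have uvT : `[u, v]%classic `<=` `[0, T]%classic.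
    move=> r; rewrite /= !in_itv/= => /andP[ur rv].
    by rewrite (le_trans u0)// (le_trans rv).
  exact: continuous_subspaceW uvT (diff_quot_continuous df).
by rewrite ler_wpM2r ?fC ?sub' ?sub// subr_ge0 ltW.
Qed.

End one_sided_derivative.

(** * Comparison of the scaled measures of two orders *)

Section scaled_measure_facts.
Context {R : realType}.
Implicit Types (p q T : R) (x : R -> R) (pi : nat -> seq R).

Lemma part_pt_itv T (s : seq R) j : itv_partition 0 T s -> (j < size s)%N ->
  [/\ 0 <= part_pt s j, part_pt s j < part_pt s j.+1 & part_pt s j.+1 <= T].
Proof.
move=> hs js.
(* [part_pt] pads with 0, the bounds on [itv_partition] with the right end [T]; for indices in range
   the two agree. *)
have nthE k : (k < (size s).+1)%N -> part_pt s k = nth T (0 :: s) k.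
  by move=> ks; apply: set_nth_default.
split.
- by rewrite nthE 1?ltnW// itv_partition_nth_ge// ltnW.
- by case: hs => /(pathP 0) + _ => /(_ j js).
- by rewrite nthE// itv_partition_nth_le.
Qed.

Lemma incr_le_mesh (s : seq R) j : (j < size s)%N ->
  part_pt s j.+1 - part_pt s j <= mesh s.
Proof.
move=> js; rewrite /mesh.
exact: (le_bigmax 0 (fun j : 'I__ => _) (Ordinal js)).
Qed.

Lemma mesh_gt0 T (s : seq R) : 0 < T -> itv_partition 0 T s -> 0 < mesh s.
Proof.
(* An empty list would force [0 = T]. *)
move=> T0 hs; have s0 : (0 < size s)%N.
  by rewrite lt0n size_eq0; apply: contraTneq T0 => s0;
    rewrite s0 in hs; rewrite (itv_partition_nil hs) ltxx.
apply: lt_le_trans (incr_le_mesh s0).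
by have [_ + _] := part_pt_itv hs s0; rewrite subr_gt0.
Qed.

Lemma dirac_sum_le (s : seq R) (w w' : nat -> {nonneg R}) (K : R) A :
  0 <= K -> (forall j, (j < size s)%N -> (w j)%:num <= K * (w' j)%:num) ->
  (dirac_sum s w A <= K%:E * dirac_sum s w' A)%E.
Proof.
move=> K0 ww'; rewrite /dirac_sum /= /msum.
rewrite ge0_sume_distrr; last by move=> j _; exact: measure_ge0.
apply: lee_sum => j _; rewrite /= /mscale /= muleA.
by apply: lee_wpmul2r => //; rewrite -EFinM lee_fin ww'.
Qed.

(** Where [0 < dphi], the factor [dphi ^ (b - a)] splits off and is monotone in [dphi] because
    [a <= b]; elsewhere the indicator annuls both sides. *)
Lemma scaled_weight_le (a b M dphi dx : R) : a <= b -> dphi <= M ->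
  scaled_weight b dphi dx <= M `^ (b - a) * scaled_weight a dphi dx.
Proof.
move=> ab dM; rewrite /scaled_weight.
have [d0|_] := ltP 0 dphi; last by rewrite !mulr0.
rewrite !mulr1 mulrA ler_wpM2r ?sqr_ge0//.
have -> : dphi `^ b = dphi `^ (b - a) * dphi `^ a.
  by rewrite -powRD ?subrK// (gt_eqF d0) implybT.
rewrite ler_wpM2r ?powR_ge0//.
by apply: ge0_ler_powR; rewrite ?subr_ge0// nnegrE ltW// (lt_le_trans d0).
Qed.

Lemma mupq_le p q q' T pi x C n A : 0 < T -> 0 < q -> q <= q' -> 0 <= C ->
  itv_partition 0 T (pi n) ->
  (forall u v, 0 <= u -> u < v -> v <= T ->
    pvar p T pi x v - pvar p T pi x u <= C * (v - u)) ->
  (mupq p q' T pi x n A <=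
    ((C * mesh (pi n)) `^ (2 / q - 2 / q'))%:E * mupq p q T pi x n A)%E.
Proof.
move=> T0 q0 qq' C0 hpi incC; apply: dirac_sum_le => [|j js /=].
  exact: powR_ge0.
have q'0 : 0 < q' by exact: lt_le_trans qq'.
have -> : 2 / q - 2 / q' = (q' - 2) / q' - (q - 2) / q.
  by rewrite !mulrBl !divff ?gt_eqF// opprB [RHS]addrC addrA subrK.
apply: scaled_weight_le.
  by rewrite !mulrBl !divff ?gt_eqF// lerB// ler_pM2l// lef_pV2.
have [u0 uv vT] := part_pt_itv hpi js.
apply: (le_trans (incC _ _ u0 uv vT)).
by rewrite ler_wpM2l// incr_le_mesh.
Qed.

Lemma mesh_powR_cvg0 T C e pi : 0 < T -> 0 < C -> 0 < e ->
  (forall n, itv_partition 0 T (pi n)) -> mesh (pi n) @[n --> \oo] --> 0 ->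
  (C * mesh (pi n)) `^ e @[n --> \oo] --> 0.
Proof.
move=> T0 C0 e0 hpi hmesh.
have Cm : C * mesh (pi n) @[n --> \oo] --> 0.
  by rewrite -(mulr0 C); apply: cvgM => //; exact: cvg_cst.
(* [powR_cvg0] takes a limit from the right, which positivity of every mesh provides. *)
suff Cm' : (C * mesh (pi n)) @[n --> \oo] --> 0^'+.
  exact: cvg_comp Cm' (powR_cvg0 e0).
move=> A A0.
have : \forall n \near \oo, 0 < C * mesh (pi n) -> A (C * mesh (pi n)).
  exact: Cm A0.
rewrite /= !nbhs_simpl; apply: filterS => n; apply.
by rewrite mulr_gt0// (mesh_gt0 T0).
Qed.

End scaled_measure_facts.

(** * Mass of [[0, t]] under weak convergence *)

Section weak_cvg_facts.
Context {R : realType}.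
Implicit Types (T t : R) (mu : borel_measure R).

(** Testing against 1, the total masses converge to the finite mass of [mu], and each [mu_ n A] is
    below the total mass. *)
Lemma weak_cvg_limn_esup_lty T (mu_ : nat -> borel_measure R)
    (mu : finite_borel_measure R) (A : set R) :
  measurable A -> A `<=` `[0, T] -> weak_cvg T mu_ mu ->
  (limn_esup (fun n => mu_ n A) < +oo)%E.
Proof.
move=> mA AT cvg_mu.
have := cvg_mu (cst 1) (@cst_continuous _ _ _).
have int1 (nu : borel_measure R) :
    (\int[nu]_(s in `[0%R, T]) 1%:E = nu `[0%R, T]%classic)%E.
  by rewrite integral_cst// mul1e.
rewrite int1; under eq_cvg do rewrite int1.
move=> /cvg_limn_einf_sup[_ muT].
apply: (@le_lt_trans _ _ (mu `[0%R, T]%classic)); last first.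
  by rewrite ltey_eq fin_num_measure.
apply/lee_addgt0Pr => e e0; apply: limn_esup_le_near.
have : (limn_esup (fun n => mu_ n `[0%R, T]%classic) <
    mu `[0%R, T]%classic + e%:E)%E.
  by rewrite muT lteDl// fin_num_measure.
move=> /limn_esup_lt_near; apply: filterS => n /ltW; apply: le_trans.
by apply: le_measure => //; rewrite inE.
Qed.

(** The function [f s = max(0, t - s)] is continuous and at most [t] times the indicator of [[0, t]]
    on [[0, T]]. Hence the masses are at least [1 / t] times the integrals of [f], whose limit is
    positive. *)
Lemma weak_cvg_limn_einf_gt0 T t (mu_ : nat -> borel_measure R) mu :
  t \in `[0, T] ->
  mu [set t] = 0%E -> (0 < mu `[0%R, t]%classic)%E -> weak_cvg T mu_ mu ->
  (0 < limn_einf (fun n => mu_ n `[0%R, t]%classic))%E.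
Proof.
(* If [t = 0], then [[0, t]] is the null set [{t}], against [mu0]. *)
rewrite in_itv/= => /andP[t0 tT] mut mu0 cvg_mu.
have {t0} t0 : 0 < t.
  rewrite lt_neqAle t0 andbT; apply: contraTneq mu0 => t_eq0.
  by rewrite -t_eq0 set_itv1 t_eq0 mut ltxx.
pose f : R -> R := cst 0 \max (fun s => t - s).
have f0 s : 0 <= f s by rewrite le_max lexx.
have cf : continuous (f : R -> R).
  refine (@max_fun_continuous _ R R (cst 0) (fun s => t - s) _ _).
    exact: cst_continuous.
  by move=> s; apply: cvgB; [exact: cvg_cst|exact: cvg_id].
have mf : measurable_fun (`[0%R, T]%classic : set (measurableTypeR R))
    (EFin \o f).
  apply/measurable_EFinP; apply: measurable_funTS.
  exact: continuous_measurable_fun.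
have f0E s : (0 <= (EFin \o f) s)%E by rewrite lee_fin.
have intf_gt0 : (0 < \int[mu]_(s in `[0%R, T]) (f s)%:E)%E.
  (* A zero integral would make [f] vanish off a null set [N]. As [f] is positive on [[0, t[], [N]
     and the null point [t] would cover [[0, t]], giving it mass 0. *)
  rewrite lt_neqAle eq_sym; apply/andP; split; last first.
    by apply: integral_ge0 => s _; exact: f0E.
  apply/eqP => intf0.
  have : (\int[mu]_(s in `[0%R, T]) `|(EFin \o f) s| = 0)%E.
    by rewrite -[RHS]intf0; apply: eq_integral => s _; rewrite gee0_abs.
  move=> /(ae_eq_integral_abs _ _ mf) => /(_ (measurable_itv _)) [N [mN N0 fN]].
  suff : (mu `[0%R, t]%classic <= 0)%E by rewrite leNgt mu0.
  apply: (@le_trans _ _ (mu (N `|` [set t]))).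
    apply: le_measure; rewrite ?inE//; first exact: measurableU.
    move=> s; rewrite /= in_itv/= => /andP[s0 st].
    have [->|st'] := eqVneq s t; first by right.
    have {st'} st' : s < t by rewrite lt_neqAle st'.
    left; apply: fN => /= fs; have [] : EFin (f s) <> 0%E; last apply: fs.
      by move=> [] /eqP; rewrite gt_eqF// /f/= lt_max subr_gt0 st' orbT.
    by rewrite in_itv/= s0 (le_trans st tT).
  apply: (le_trans (measureU2 _ mN (measurable_set1 _))).
  by apply: adde_le0; [have /eqP := N0|have /eqP := mut];
    rewrite eq_le => /andP[].
have le_int n : (\int[mu_ n]_(s in `[0%R, T]) (f s)%:E <=
    t%:E * mu_ n `[0%R, t]%classic)%E.
  have -> : (mu_ n `[0%R, t]%classic =
      \int[mu_ n]_(s in `[0%R, T]) (\1_(`[0%R, t]%classic) s)%:E)%E.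
    rewrite integral_indic//; congr (mu_ n _).
    apply/seteqP; split => s //=; last by case.
    rewrite !in_itv/= => /andP[-> st]; split => //=.
    exact: le_trans tT.
  have m1 : measurable_fun (`[0%R, T]%classic : set (measurableTypeR R))
      (EFin \o (\1_(`[0%R, t]%classic : set (measurableTypeR R)) : _ -> R)).
    by apply/measurable_EFinP; exact: measurable_indic.
  rewrite -ge0_integralZl_EFin//; last exact: ltW.
  apply: ge0_le_integral => //.
  - by move=> s _; exact: f0E.
  - exact: measurable_funeM m1.
  move=> s; rewrite /= in_itv/= => /andP[s0 _].
  rewrite -EFinM lee_fin indicE mem_setE in_itv/= s0/= /f/=.
  have [st|/ltW st] := leP s t; rewrite ge_max; last first.
    by rewrite mulr0 lexx subr_le0.
  by rewrite mulr1 (ltW t0) gerBl.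
have [intf _] := cvg_limn_einf_sup (cvg_mu f (continuous_subspaceT cf)).
rewrite -intf in intf_gt0.
have [d d0 /lt_limn_einf_near dint] := ereal_gt0_EFin intf_gt0.
apply: (@lt_le_trans _ _ (d / t)%:E); first by rewrite lte_fin divr_gt0.
apply: le_limn_einf_near; apply: filterS dint => n.
move=> /ltW /le_trans /(_ (le_int n)).
by rewrite mulrC EFinM lee_pdivrMl.
Qed.

End weak_cvg_facts.

(** * The five claims, by comparison with order [p] *)

Theorem lemma2p11 (R : realType) (p T : R) (hp : 1 <= p) (hT : 0 < T)
  (pi : nat -> seq R) (hpi : forall n, itv_partition 0 T (pi n))
  (hmesh : mesh (pi n) @[n --> \oo] --> 0)
  (x : R -> R) (hx : in_Vp p T pi x)
  (hphi : C1b T (pvar p T pi x))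
  (c C : R) (hc : 0 < c)
  (hcC : forall s, s \in `[0, T] -> c <= derive_on T (pvar p T pi x) s <= C)
  (t : R) (ht : t \in `[0, T]) :
  (* (1) *)
  (in_Sp p T pi x -> 0 < sqv p T pi x t ->
     (forall q, 0 < q -> q < p ->
        mupq p q T pi x n `[0, t]%classic @[n --> \oo] --> +oo%E) /\
     (forall q, 0 < q -> p < q ->
        mupq p q T pi x n `[0, t]%classic @[n --> \oo] --> 0%E)) /\
  (* (2a) *)
  ((limn_esup (fun n => sqv_n p T pi x n t) < +oo)%E ->
     forall q, 0 < q -> p < q ->
       limn_esup (fun n => mupq p q T pi x n `[0, t]%classic) = 0%E) /\
  (* (2b) *)
  ((0 < limn_esup (fun n => sqv_n p T pi x n t))%E ->
     forall q, 0 < q -> q < p ->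
       limn_esup (fun n => mupq p q T pi x n `[0, t]%classic) = +oo%E) /\
  (* (3a) *)
  ((limn_einf (fun n => sqv_n p T pi x n t) < +oo)%E ->
     forall q, 0 < q -> p < q ->
       limn_einf (fun n => mupq p q T pi x n `[0, t]%classic) = 0%E) /\
  (* (3b) *)
  ((0 < limn_einf (fun n => sqv_n p T pi x n t))%E ->
     forall q, 0 < q -> q < p ->
       limn_einf (fun n => mupq p q T pi x n `[0, t]%classic) = +oo%E).
Proof.
have C0 : 0 < C.
  have /hcC/andP[cC Cc] : 0 \in `[0, T] by rewrite in_itv/= lexx ltW.
  exact: lt_le_trans hc (le_trans cC Cc).
have p0 : 0 < p by exact: lt_le_trans hp.
have [dphi _ _ _] := hphi.
have incC u v : 0 <= u -> u < v -> v <= T ->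
    pvar p T pi x v - pvar p T pi x u <= C * (v - u).
  by apply: incr_le_derive_on => // r /hcC/andP[].
pose A := `[0, t]%classic : set R.
(* [mu p n] is [sqv_n p T pi x n t] by unfolding, so facts about [mu] at order [p] apply to the
   scaled quadratic variation as they stand. *)
pose mu q n := mupq p q T pi x n A.
pose K q q' n := (C * mesh (pi n)) `^ (2 / q - 2 / q').
have mu0 q n : (0 <= mu q n)%E by exact: measure_ge0.
have K0 q q' n : 0 <= K q q' n by exact: powR_ge0.
have Kcvg q q' : 0 < q -> q < q' -> K q q' n @[n --> \oo] --> 0.
  move=> q0 qq'; apply: (mesh_powR_cvg0 hT C0) => //.
  by rewrite subr_gt0 ltr_pM2l// ltf_pV2// posrE (lt_trans q0).
have muK q q' : 0 < q -> q < q' ->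
    forall n, (mu q' n <= (K q q' n)%:E * mu q n)%E.
  by move=> q0 /ltW qq' n; apply: mupq_le => //; exact: ltW.
have sup_lt q q' : 0 < q -> q < q' -> (limn_esup (mu q) < +oo)%E ->
    mu q' n @[n --> \oo] --> 0%E.
  move=> q0 qq'.
  exact: limn_esup_dominated (mu0 q') (K0 q q') (Kcvg _ _ q0 qq')
    (muK _ _ q0 qq').
have inf_gt q q' : 0 < q -> q < q' -> (0 < limn_einf (mu q'))%E ->
    limn_einf (mu q) = +oo%E.
  move=> q0 qq'.
  exact: limn_einf_dominating (mu0 q) (K0 q q') (Kcvg _ _ q0 qq')
    (muK _ _ q0 qq').
split; [|split; [|split; [|split]]].
(* [in_Sp] provides an atomless limit, so [weak_limit] does not take its default value [mzero]. *)
- move=> [_ ex_mu]; rewrite /sqv /weak_limit; case: pselect => // h.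
  have [nuT nu1 cvg_nu] := projT2 (cid h).
  set nu := projT1 _ in nuT nu1 cvg_nu *.
  (* [fine] sends 0 to 0, so a positive [fine (nu A)] excludes [nu A = 0]. *)
  move=> nuA; have {}nuA : (0 < nu A)%E.
    rewrite lt_neqAle measure_ge0 andbT; apply: contraTneq nuA => nuA0.
    by rewrite -[X in fine X]nuA0 ltxx.
  have AT : A `<=` `[0, T]%classic.
    move=> s; rewrite /A /= !in_itv/= => /andP[-> /=] /le_trans; apply.
    by move: ht; rewrite in_itv/= => /andP[].
  split=> q q0 pq.
    apply: limn_einf_pinfty_cvg; apply: (inf_gt _ p) => //.
    exact: weak_cvg_limn_einf_gt0 ht (nu1 t) nuA cvg_nu.
  apply: (sup_lt p) => //.
  by apply: weak_cvg_limn_esup_lty AT cvg_nu; exact: measurable_itv.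
- by move=> muoo q q0 pq; apply: (cvg_limn_einf_sup (sup_lt p _ _ _ _)).2.
(* By contradiction: a finite upper limit at order [q < p] would send the masses of order [p] to
   0. *)
- move=> mugt0 q q0 qp; apply/eqP; rewrite eq_le leey/=.
  rewrite leNgt; apply/negP => muq.
  have [_ mup] := cvg_limn_einf_sup (sup_lt _ _ q0 qp muq).
  by rewrite /sqv_n -/(mu p) mup ltxx in mugt0.
(* By contradiction: a positive lower limit at order [q > p] would make the one at order [p]
   infinite. *)
- move=> muoo q q0 pq; apply/eqP; rewrite eq_le; apply/andP; split.
    rewrite leNgt; apply/negP => /(inf_gt _ _ p0 pq) mup.
    by move: muoo; rewrite -[limn_einf _]/(limn_einf (mu p)) mup ltxx.
  by apply: le_limn_einf_near; apply: nearW => n; exact: mu0.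
- by move=> mugt0 q q0 qp; apply: (inf_gt _ p).
Qed.
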